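(* Let $\Omega\subset\mathbb{C}$ be a domain, $u:\Omega\to\mathbb{R}$, and let $f_0:\Omega\to\mathbb{R}$ be a nonvanishing solution of $(-\partial_z\partial_{\overline z}+u)f=0$ in $\Omega$. Suppose that $f_0=f_0(\rho)$ is a function of a real valued function $\rho$ on $\Omega$ with nonvanishing gradient, such that $\frac{\Delta\rho}{|\operatorname{grad}\rho|^2}=s(\rho)$ is a function of $\rho$, and let $S(\rho)=\int s(\rho)\,d\rho$ be an antiderivative of $s$. Put $$F=\frac1{f_0},\quad G=if_0,\qquad F_I=if_0e^{-S}\rho_z,\quad G_I=-\frac{e^{-S}\rho_z}{f_0}.$$ Then $(F_I,G_I)$ is a generating pair in $\Omega$ for the equation $v_{\overline z}=\overline{b}\,\overline{v}$, $b=-\partial_{\overline z}f_0/f_0$ (that is, $a_{(F_I,G_I)}=0$ and $b_{(F_I,G_I)}=\overline{b}$). Its adjoint pair is $F_I^{*}=-\frac{f_0e^{S}}{\rho_z}$, $G_I^{*}=-\frac{ie^{S}}{f_0\rho_z}$. For real valued $\phi,\psi$ the function $v=\phi F_I+\psi G_I$ is $(F_I,G_I)$-pseudoanalytic if and only if the function $W=\phi F_I^{*}+\psi G_I^{*}$ is $(F_I^{*},G_I^{*})$-pseudoanalytic. Moreover, $(F,G)$ is a successor of $(F_I^{*},G_I^{*})$.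
   Context: $z=x+iy$; $\partial_{\overline z}=\frac{\partial}{\partial x}+i\frac{\partial}{\partial y}$, $\partial_z=\frac{\partial}{\partial x}-i\frac{\partial}{\partial y}$ (no factor $1/2$), so $\partial_z\partial_{\overline z}=\Delta$; subscripts $z,\overline z$ denote application of these operators. A generating pair in $\Omega$ is a pair of complex functions $(F,G)$ possessing partial derivatives in $x,y$ with $\operatorname{Im}(\overline{F}G)>0$ in $\Omega$. Its characteristic coefficients are $$a_{(F,G)}=-\frac{\overline{F}G_{\overline z}-F_{\overline z}\overline{G}}{F\overline{G}-\overline{F}G},\quad b_{(F,G)}=\frac{FG_{\overline z}-F_{\overline z}G}{F\overline{G}-\overline{F}G},\quad A_{(F,G)}=-\frac{\overline{F}G_z-F_z\overline{G}}{F\overline{G}-\overline{F}G},\quad B_{(F,G)}=\frac{FG_z-F_zG}{F\overline{G}-\overline{F}G}.$$ A function $w=\phi F+\psi G$ with $\phi,\psi$ real valued (differentiable) is $(F,G)$-pseudoanalytic if $\phi_{\overline z}F+\psi_{\overline z}G=0$; equivalently $w_{\overline z}=a_{(F,G)}w+b_{(F,G)}\overline{w}$. The pair $(F_1,G_1)$ is a successor of $(F,G)$ if $a_{(F_1,G_1)}=a_{(F,G)}$ and $b_{(F_1,G_1)}=-B_{(F,G)}$. The adjoint generating pair of $(F,G)$ is $F^{*}=-\frac{2\overline{F}}{F\overline{G}-\overline{F}G}$, $G^{*}=\frac{2\overline{G}}{F\overline{G}-\overline{F}G}$. The functions $f_0$ and $\rho$ are twice continuously differentiable, $s$ is continuous,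 and $S$ is evaluated at $\rho(x,y)$. *)

(* Defs.v *)
From Stdlib Require Export Reals.
From Coquelicot Require Export Coquelicot.

(* Functions on a plane domain Omega are represented by total functions on C;
   only their values on Omega matter, since Omega is open and every notion
   below is local. *)

Definition plane_domain (Omega : C -> Prop) : Prop :=
  open (T := C_UniformSpace) Omega /\
  (exists z, Omega z) /\
  (forall U V : C -> Prop,
     open (T := C_UniformSpace) U -> open (T := C_UniformSpace) V ->
     (forall z, Omega z -> U z \/ V z) ->
     (exists z, Omega z /\ U z) -> (exists z, Omega z /\ V z) ->
     exists z, Omega z /\ U z /\ V z).

Definition dx (h : C -> R) (z : C) : R := Derive (fun t : R => h (t, Im z)) (Re z).
Definition dy (h : C -> R) (z : C) : R := Derive (fun t : R => h (Re z, t)) (Im z).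

Definition has_partials (h : C -> R) (z : C) : Prop :=
  ex_derive (fun t : R => h (t, Im z)) (Re z) /\
  ex_derive (fun t : R => h (Re z, t)) (Im z).

Definition laplacian (h : C -> R) (z : C) : R := (dx (dx h) z + dy (dy h) z)%R.
Definition grad (h : C -> R) (z : C) : R * R := (dx h z, dy h z).
Definition grad_norm2 (h : C -> R) (z : C) : R := (dx h z ^ 2 + dy h z ^ 2)%R.

Definition C2_on (Omega : C -> Prop) (h : C -> R) : Prop :=
  forall z, Omega z -> ex_diff_n (fun x y => h (x, y)) 2 (Re z) (Im z).

Definition differentiable_on (Omega : C -> Prop) (h : C -> R) : Prop :=
  forall z, Omega z -> differentiable_pt (fun x y => h (x, y)) (Re z) (Im z).

Open Scope C_scope.

Definition Cdx (f : C -> C) (z : C) : C :=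
  (dx (fun w => Re (f w)) z, dx (fun w => Im (f w)) z).
Definition Cdy (f : C -> C) (z : C) : C :=
  (dy (fun w => Re (f w)) z, dy (fun w => Im (f w)) z).

Definition has_Cpartials (f : C -> C) (z : C) : Prop :=
  has_partials (fun w => Re (f w)) z /\ has_partials (fun w => Im (f w)) z.

(* No factor 1/2, so that dz (dzbar h) is the Laplacian of h. *)
Definition dz (f : C -> C) (z : C) : C := Cdx f z - Ci * Cdy f z.
Definition dzbar (f : C -> C) (z : C) : C := Cdx f z + Ci * Cdy f z.

Definition cplx (h : C -> R) : C -> C := fun z => RtoC (h z).

Definition generating_pair (Omega : C -> Prop) (F G : C -> C) : Prop :=
  forall z, Omega z ->
    has_Cpartials F z /\ has_Cpartials G z /\ (0 < Im (Cconj (F z) * G z))%R.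

Definition pair_den (F G : C -> C) (z : C) : C :=
  F z * Cconj (G z) - Cconj (F z) * G z.

Definition char_a (F G : C -> C) (z : C) : C :=
  - ((Cconj (F z) * dzbar G z - dzbar F z * Cconj (G z)) / pair_den F G z).
Definition char_b (F G : C -> C) (z : C) : C :=
  (F z * dzbar G z - dzbar F z * G z) / pair_den F G z.
Definition char_B (F G : C -> C) (z : C) : C :=
  (F z * dz G z - dz F z * G z) / pair_den F G z.

Definition pseudoanalytic (Omega : C -> Prop) (F G w : C -> C) : Prop :=
  exists phi psi : C -> R,
    differentiable_on Omega phi /\ differentiable_on Omega psi /\
    forall z, Omega z ->
      w z = RtoC (phi z) * F z + RtoC (psi z) * G z /\
      dzbar (cplx phi) z * F z + dzbar (cplx psi) z * G z = 0.

(* The pair (F1, G1) is a successor of the pair (F, G). *)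
Definition successor (Omega : C -> Prop) (F G F1 G1 : C -> C) : Prop :=
  generating_pair Omega F G /\ generating_pair Omega F1 G1 /\
  forall z, Omega z ->
    char_a F1 G1 z = char_a F G z /\ char_b F1 G1 z = - char_B F G z.

Definition adjoint_F (F G : C -> C) (z : C) : C :=
  - (RtoC 2 * Cconj (F z) / pair_den F G z).
Definition adjoint_G (F G : C -> C) (z : C) : C :=
  RtoC 2 * Cconj (G z) / pair_den F G z.

(* Main.v *)
Require Import Defs.
From Stdlib Require Import Reals Lra.
From Coquelicot Require Import Coquelicot.
Open Scope C_scope.

(** Write [h = 1/f0] and [P = e^(-S(rho)) rho_z]. Two facts about [rho] carry
    the analysis.

    - [P] is holomorphic: the zbar-derivative of [rho_z] is the Laplacian of
      [rho], that of [S(rho)] is [s(rho) rho_zbar], and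
      [rho_z rho_zbar = |grad rho|^2], so the two terms of the product rule
      cancel exactly when [s(rho) = Laplacian rho / |grad rho|^2]
      ([antiderivative_factor_holomorphic]).
    - As [f0] is constant on the level curves of [rho], the gradients of [f0]
      and [rho] are parallel, that is [f0_zbar rho_z = f0_z rho_zbar]
      ([function_of_dzbar_dz]). The function [g] with [f0 = g(rho)] comes
      without any regularity, so the chain rule is replaced by a direct
      argument on level curves ([level_set_gradients_parallel]).

    Everything else is algebra on one family of pairs. For a real [h] and a
    holomorphic [Q], both without zeros, put [pair h Q = (Q/h, i h Q)]. Its
    coefficients are
    [a = 0], [b = - (Q / conj Q) h_zbar / h], [B = - (Q / conj Q) h_z / h]
    ([pair_coefficients]), and its adjoint is [pair h (1/(iQ))]
    ([pair_adjoint]). All three pairs of the theorem belong to this family: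
    [(F, G) = pair f0 1], [(F_I, G_I) = pair (1/f0) (iP)] and hence
    [pair (1/f0) (-1/P)] for its adjoint.
    The parallel gradients say that the phase [P / conj P] turns [f0_zbar]
    into [f0_z]; this gives both the value of [b] for [(F_I, G_I)] and the
    successor relation. Finally, multiplying a pair and a function by a common
    factor without zeros does not affect the equation
    [phi_zbar F + psi_zbar G = 0], so pseudoanalyticity of [phi F + psi G] does
    not depend on [Q] ([pseudoanalytic_pair]), which is the transfer between
    [(F_I, G_I)] and its adjoint. *)

(** * Complex-valued derivatives and the two Wirtinger derivatives *)

Definition is_Cderive (h : R -> C) (t : R) (l : C) : Prop :=
  is_derive (fun s => Re (h s)) t (Re l) /\ is_derive (fun s => Im (h s)) t (Im l).

Lemma is_Cderive_mult h k t l m :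
  is_Cderive h t l -> is_Cderive k t m ->
  is_Cderive (fun s => h s * k s) t (l * k t + h t * m).
Proof.
  intros [h1 h2] [k1 k2]; split.
  - evar_last.
    + apply (is_derive_minus (fun s => Re (h s) * Re (k s))%R
               (fun s => Im (h s) * Im (k s))%R);
        apply Derive.is_derive_mult; eassumption.
    + unfold minus, plus, opp; simpl; unfold Re, Im; ring.
  - evar_last.
    + apply (is_derive_plus (fun s => Re (h s) * Im (k s))%R
               (fun s => Im (h s) * Re (k s))%R);
        apply Derive.is_derive_mult; eassumption.
    + unfold plus; simpl; unfold Re, Im; ring.
Qed.

Lemma C_neq_0_norm (c : C) : c <> 0 -> (Re c ^ 2 + Im c ^ 2 <> 0)%R.
Proof.
  intros hc e; apply hc; destruct c as [a b]; unfold Re, Im in e; simpl in e.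
  assert (ha : a = 0%R) by nra. assert (hb : b = 0%R) by nra.
  subst; reflexivity.
Qed.

Lemma is_Cderive_inv h t l :
  is_Cderive h t l -> h t <> 0 ->
  is_Cderive (fun s => / h s) t (- (l / (h t * h t))).
Proof.
  intros [h1 h2] nz; pose proof (C_neq_0_norm _ nz) as nn.
  assert (hn : is_derive (fun s => Re (h s) ^ 2 + Im (h s) ^ 2)%R t
                 (2 * Re l * Re (h t) + 2 * Im l * Im (h t))%R).
  { evar_last.
    - apply (is_derive_plus (fun s => Re (h s) ^ 2)%R (fun s => Im (h s) ^ 2)%R);
        apply is_derive_pow; eassumption.
    - unfold plus; simpl; ring. }
  assert (nq : (Re (h t * h t) ^ 2 + Im (h t * h t) ^ 2 <> 0)%R).
  { apply C_neq_0_norm, Cmult_neq_0; exact nz. }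
  unfold Re, Im in *; destruct l as [l1 l2]; split.
  - evar_last.
    + apply (is_derive_div (fun s => fst (h s)) (fun s => fst (h s) ^ 2 + snd (h s) ^ 2)%R);
        eassumption.
    + destruct (h t) as [a b]; simpl in *.
      field; repeat split; intros e; first [apply nn; rewrite <- e; ring | apply nq; rewrite <- e; ring].
  - evar_last.
    + apply (is_derive_div (fun s => - snd (h s))%R (fun s => fst (h s) ^ 2 + snd (h s) ^ 2)%R).
      * apply (is_derive_opp (fun s => snd (h s))); eassumption.
      * eassumption.
      * assumption.
    + unfold opp; destruct (h t) as [a b]; simpl in *.
      field; repeat split; intros e; first [apply nn; rewrite <- e; ring | apply nq; rewrite <- e; ring].
Qed.

(** Bundles the existence of all partial derivatives of [f] at [z] with the
    values [p] of [dz f z] and [q] of [dzbar f z], so that one rule per operation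
    serves both the existence claims and the computations. *)
Definition has_wirtinger (f : C -> C) (z p q : C) : Prop :=
  exists fx fy : C,
    is_Cderive (fun t => f (t, Im z)) (Re z) fx /\
    is_Cderive (fun t => f (Re z, t)) (Im z) fy /\
    p = fx - Ci * fy /\ q = fx + Ci * fy.

Lemma has_wirtinger_unique f z p q :
  has_wirtinger f z p q -> has_Cpartials f z /\ dz f z = p /\ dzbar f z = q.
Proof.
  intros (fx & fy & [x1 x2] & [y1 y2] & -> & ->).
  assert (ex : Cdx f z = fx).
  { apply injective_projections; apply is_derive_unique; assumption. }
  assert (ey : Cdy f z = fy).
  { apply injective_projections; apply is_derive_unique; assumption. }
  split; [|unfold dz, dzbar; rewrite ex, ey; split; reflexivity].
  split; split; eexists; eassumption.
Qed.

Lemma has_wirtinger_mult f g z p q p' q' :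
  has_wirtinger f z p q -> has_wirtinger g z p' q' ->
  has_wirtinger (fun w => f w * g w) z (p * g z + f z * p') (q * g z + f z * q').
Proof.
  intros (fx & fy & hx & hy & -> & ->) (gx & gy & kx & ky & -> & ->).
  destruct z as [x y].
  exists (fx * g (x, y) + f (x, y) * gx), (fy * g (x, y) + f (x, y) * gy).
  split; [|split; [|split]].
  - exact (is_Cderive_mult _ _ _ _ _ hx kx).
  - exact (is_Cderive_mult _ _ _ _ _ hy ky).
  - ring.
  - ring.
Qed.

Lemma has_wirtinger_inv f z p q :
  has_wirtinger f z p q -> f z <> 0 ->
  has_wirtinger (fun w => / f w) z (- (p / (f z * f z))) (- (q / (f z * f z))).
Proof.
  intros (fx & fy & hx & hy & -> & ->) nz.
  destruct z as [x y].
  exists (- (fx / (f (x, y) * f (x, y)))), (- (fy / (f (x, y) * f (x, y)))).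
  split; [|split; [|split]].
  - exact (is_Cderive_inv _ _ _ hx nz).
  - exact (is_Cderive_inv _ _ _ hy nz).
  - field; exact nz.
  - field; exact nz.
Qed.

Lemma has_wirtinger_const c z : has_wirtinger (fun _ => c) z 0 0.
Proof.
  exists 0, 0; split; [|split; [|split]]; try ring;
    split; apply (is_derive_const (K := R_AbsRing) (V := R_NormedModule)).
Qed.

Lemma has_wirtinger_real (h : C -> R) z (a b : R) :
  is_derive (fun t => h (t, Im z)) (Re z) a ->
  is_derive (fun t => h (Re z, t)) (Im z) b ->
  has_wirtinger (cplx h) z (RtoC a - Ci * RtoC b) (RtoC a + Ci * RtoC b).
Proof.
  intros ha hb; exists (RtoC a), (RtoC b).
  split; [|split; [|split]]; try reflexivity; split; try assumption;
    exact (is_derive_const (K := R_AbsRing) (V := R_NormedModule) 0%R _).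
Qed.

Lemma has_wirtinger_minus f g z p q p' q' :
  has_wirtinger f z p q -> has_wirtinger g z p' q' ->
  has_wirtinger (fun w => f w - g w) z (p - p') (q - q').
Proof.
  intros (fx & fy & [hx hx'] & [hy hy'] & -> & ->)
         (gx & gy & [kx kx'] & [ky ky'] & -> & ->).
  exists (fx - gx), (fy - gy).
  split; [|split; [|split]]; try ring; split.
  - exact (is_derive_minus _ _ _ _ _ hx kx).
  - exact (is_derive_minus _ _ _ _ _ hx' kx').
  - exact (is_derive_minus _ _ _ _ _ hy ky).
  - exact (is_derive_minus _ _ _ _ _ hy' ky').
Qed.

Lemma open_locally_2d (Omega : C -> Prop) (z : C) :
  open (T := C_UniformSpace) Omega -> Omega z ->
  locally_2d (fun u v => Omega (u, v)) (Re z) (Im z).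
Proof.
  intros ho hz; destruct (ho z hz) as [d hd]; exists d; intros u v hu hv.
  apply hd; split; assumption.
Qed.

Lemma has_wirtinger_ext (Omega : C -> Prop) f g z p q :
  open (T := C_UniformSpace) Omega -> Omega z ->
  (forall w, Omega w -> f w = g w) ->
  has_wirtinger f z p q -> has_wirtinger g z p q.
Proof.
  intros ho hz e (fx & fy & [hx hx'] & [hy hy'] & ep & eq).
  pose proof (open_locally_2d _ _ ho hz) as hl.
  pose proof (locally_2d_1d_const_y _ _ _ hl) as lx.
  pose proof (locally_2d_1d_const_x _ _ _ hl) as ly.
  exists fx, fy; split; [|split; [|split]]; try assumption; split;
    (eapply is_derive_ext_loc; [|eassumption]);
    (eapply filter_imp; [|first [exact lx | exact ly]]);
    intros t ht; cbn; rewrite (e _ ht); reflexivity.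
Qed.

(** * Functions constant on the level curves of another function *)

(** If [r_x <> 0], the level curve of [r] through the point leaves it in the
    direction [(-m, 1)] with [m = r_y / r_x]. On the horizontal segment at height
    [y + h] with abscissas [x + t h], [|t + m| <= eta], the expansion of [r] to first
    order gives opposite signs of [r - r x y] at the two ends, so the level curve
    crosses that segment. As [f] keeps its value at the crossing, its expansion
    bounds the derivative of [f] along [(-m, 1)] by a multiple of [eta], for
    every [eta]. *)
Lemma level_set_slope (f r : R -> R -> R) (x y a b c d : R) :
  differentiable_pt_lim f x y a b -> differentiable_pt_lim r x y c d ->
  locally_2d (fun u v => continuity_2d_pt r u v) x y ->
  locally_2d (fun u v => r u v = r x y -> f u v = f x y) x y ->
  c <> 0%R -> (a * d = b * c)%R.
Proof.
  intros hf hr hc hl nc.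
  (* |t| <= M whenever |t + m| <= 1, so all the points below lie within h * M
     of (x, y) in the sup norm. *)
  set (m := (d / c)%R). set (M := (Rabs m + 2)%R).
  assert (hM : (0 < M)%R) by (unfold M; pose proof (Rabs_pos m); lra).
  assert (hac : (0 < Rabs c)%R) by (apply Rabs_pos_lt; assumption).
  assert (key : forall eta, (0 < eta <= 1)%R ->
     (Rabs (b - a * m) <= eta * (1 + Rabs a))%R).
  { intros eta he.
    (* The precision on r keeps the first-order term h * c * eta dominant at the
       two ends; the precision on f makes its error at most h * eta. *)
    assert (he1 : (0 < Rabs c * eta / (2 * M))%R).
    { apply Rdiv_lt_0_compat; [apply Rmult_lt_0_compat; lra | lra]. }
    assert (he2 : (0 < eta / M)%R) by (apply Rdiv_lt_0_compat; lra).
    destruct (locally_2d_and _ _ _ _ (hr (mkposreal _ he1))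
      (locally_2d_and _ _ _ _ (hf (mkposreal _ he2))
         (locally_2d_and _ _ _ _ hc hl))) as [D hD].
    simpl in hD.
    set (h := (D / (2 * M))%R).
    assert (hD0 := cond_pos D).
    assert (hh : (0 < h)%R) by (apply Rdiv_lt_0_compat; lra).
    assert (hhM : (h * M = D / 2)%R) by (unfold h; field; lra).
    assert (box : forall t, (- m - eta <= t <= - m + eta)%R ->
       (Rabs (x + t * h - x) <= h * M /\ Rabs (y + h - y) <= h * M)%R).
    { intros t ht.
      replace (x + t * h - x)%R with (h * t)%R by ring.
      replace (y + h - y)%R with (h * 1)%R by ring.
      rewrite !Rabs_mult, Rabs_R1, (Rabs_pos_eq h) by lra.
      assert (Rabs t <= M)%R.
      { unfold M; apply Rabs_le; split_Rabs; lra. }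
      split; apply Rmult_le_compat_l; try lra.
      unfold M; pose proof (Rabs_pos m); lra. }
    assert (pt : forall t, (- m - eta <= t <= - m + eta)%R ->
       (Rabs (r (x + t * h) (y + h) - r x y - h * (c * t + d))
          <= h * (Rabs c * eta / 2) /\
        Rabs (f (x + t * h) (y + h) - f x y - h * (a * t + b)) <= h * eta)%R /\
       continuity_2d_pt r (x + t * h) (y + h) /\
       (r (x + t * h) (y + h) = r x y -> f (x + t * h) (y + h) = f x y)%R).
    { intros t ht; destruct (box t ht) as [b1 b2].
      destruct (hD (x + t * h)%R (y + h)%R) as (q1 & q2 & q3 & q4); try lra.
      pose proof (Rmax_lub _ _ _ b1 b2) as bm.
      split; [split|split; assumption].
      - replace (h * (c * t + d))%R with (c * (x + t * h - x) + d * (y + h - y))%R by ring.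
        eapply Rle_trans; [exact q1|].
        replace (h * (Rabs c * eta / 2))%R with
          (Rabs c * eta / (2 * M) * (h * M))%R by (field; lra).
        apply Rmult_le_compat_l; lra.
      - replace (h * (a * t + b))%R with (a * (x + t * h - x) + b * (y + h - y))%R by ring.
        eapply Rle_trans; [exact q2|].
        replace (h * eta)%R with (eta / M * (h * M))%R by (field; lra).
        apply Rmult_le_compat_l; lra. }
    assert (hcm : (c * m = d)%R) by (unfold m; field; assumption).
    (* The factor c makes the value negative on the left and positive on the
       right, whatever the sign of c. *)
    destruct (Ranalysis5.IVT_interv (fun t => c * (r (x + t * h) (y + h) - r x y))%R
                (- m - eta) (- m + eta)) as [t [ht e]].
    - intros t ht; destruct (pt t ht) as (_ & ct & _).
      apply continuity_pt_mult; [apply continuity_pt_const; intros ? ?; reflexivity|].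
      apply continuity_pt_minus; [|apply continuity_pt_const; intros ? ?; reflexivity].
      apply continuity_pt_filterlim.
      apply (continuous_comp_2 (fun t => x + t * h)%R (fun _ => y + h)%R r).
      + apply continuity_pt_filterlim; reg.
      + apply continuous_const.
      + apply continuity_2d_pt_filterlim; exact ct.
    - lra.
    - destruct (pt (- m - eta)%R) as ((q & _) & _); [lra|].
      set (V := (r _ _ - r x y)%R) in *.
      replace (h * (c * (- m - eta) + d))%R with (- (h * c * eta))%R in q
        by (rewrite <- hcm; ring).
      apply Rabs_le_between in q.
      assert (hk : (0 < h * (Rabs c * eta / 2))%R)
        by (apply Rmult_lt_0_compat; [|apply Rdiv_lt_0_compat; [apply Rmult_lt_0_compat|]]; lra).
      destruct (Rcase_abs c) as [cneg|cpos].
      + rewrite (Rabs_left c cneg) in q, hk. assert (0 < V)%R by lra. nra.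
      + rewrite (Rabs_right c cpos) in q, hk. assert (V < 0)%R by lra. nra.
    - destruct (pt (- m + eta)%R) as ((q & _) & _); [lra|].
      set (V := (r _ _ - r x y)%R) in *.
      replace (h * (c * (- m + eta) + d))%R with (h * c * eta)%R in q
        by (rewrite <- hcm; ring).
      apply Rabs_le_between in q.
      assert (hk : (0 < h * (Rabs c * eta / 2))%R)
        by (apply Rmult_lt_0_compat; [|apply Rdiv_lt_0_compat; [apply Rmult_lt_0_compat|]]; lra).
      destruct (Rcase_abs c) as [cneg|cpos].
      + rewrite (Rabs_left c cneg) in q, hk. assert (V < 0)%R by lra. nra.
      + rewrite (Rabs_right c cpos) in q, hk. assert (0 < V)%R by lra. nra.
    - destruct (pt t ht) as ((_ & q) & _ & imp).
      apply Rmult_integral in e; destruct e as [e|e]; [contradiction|].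
      rewrite imp in q by lra.
      replace (f x y - f x y - h * (a * t + b))%R with (h * (- (a * t + b)))%R in q by ring.
      rewrite Rabs_mult, Rabs_Ropp, (Rabs_pos_eq h) in q by lra.
      apply Rmult_le_reg_l in q; [|assumption].
      replace (b - a * m)%R with ((a * t + b) - a * (t + m))%R by ring.
      eapply Rle_trans; [apply Rabs_triang|].
      rewrite Rabs_Ropp, Rabs_mult.
      assert (Rabs (t + m) <= eta)%R by (apply Rabs_le; lra).
      pose proof (Rabs_pos a).
      nra. }
  assert (z0 : (b - a * m = 0)%R).
  { destruct (Req_dec (b - a * m) 0) as [|ne]; [assumption|exfalso].
    apply Rabs_pos_lt in ne. pose proof (Rabs_pos a) as a_ge0.
    set (B := Rabs (b - a * m)) in *.
    set (e := Rmin 1 (B / (2 * (1 + Rabs a)))).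
    assert (quot_gt0 : (0 < B / (2 * (1 + Rabs a)))%R) by (apply Rdiv_lt_0_compat; lra).
    pose proof (Rmin_l 1 (B / (2 * (1 + Rabs a)))) as e_le1.
    pose proof (Rmin_r 1 (B / (2 * (1 + Rabs a)))) as le.
    assert (e_gt0 : (0 < e)%R) by (apply Rmin_glb_lt; lra).
    assert (k := key e (conj e_gt0 e_le1)).
    assert (e * (1 + Rabs a) <= B / 2)%R.
    { replace (B / 2)%R with (B / (2 * (1 + Rabs a)) * (1 + Rabs a))%R by (field; lra).
      apply Rmult_le_compat_r; [lra|exact le]. }
    lra. }
  replace d with (m * c)%R by (unfold m; field; assumption).
  replace b with (a * m)%R by lra. ring.
Qed.

(** When [c = 0] but [d <> 0], the slope argument applies after exchanging the
    two coordinates. *)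
Lemma level_set_gradients_parallel (f r : R -> R -> R) (x y a b c d : R) :
  differentiable_pt_lim f x y a b -> differentiable_pt_lim r x y c d ->
  locally_2d (fun u v => continuity_2d_pt r u v) x y ->
  locally_2d (fun u v => r u v = r x y -> f u v = f x y) x y ->
  (a * d = b * c)%R.
Proof.
  assert (sw : forall P p q, locally_2d P p q -> locally_2d (fun u v => P v u) q p).
  { intros P p q [e he]; exists e; intros u v hu hv; apply he; assumption. }
  intros hf hr hc hl.
  destruct (Req_dec c 0) as [c0|nc];
    [|exact (level_set_slope f r x y a b c d hf hr hc hl nc)].
  destruct (Req_dec d 0) as [d0|nd]; [subst; ring|].
  symmetry.
  apply (level_set_slope (fun v u => f u v) (fun v u => r u v) y x); try assumption.
  - intros eps; eapply locally_2d_impl; [|exact (sw _ _ _ (hf eps))].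
    apply locally_2d_forall; intros u v q; cbn in q |- *.
    rewrite (Rmax_comm (Rabs (u - y))), (Rplus_comm (b * _)); exact q.
  - intros eps; eapply locally_2d_impl; [|exact (sw _ _ _ (hr eps))].
    apply locally_2d_forall; intros u v q; cbn in q |- *.
    rewrite (Rmax_comm (Rabs (u - y))), (Rplus_comm (d * _)); exact q.
  - eapply locally_2d_impl; [|exact (sw _ _ _ hc)].
    apply locally_2d_forall; intros u v q eps; exact (sw _ _ _ (q eps)).
  - exact (sw _ _ _ hl).
Qed.

(** * Twice continuously differentiable real functions *)

Lemma C2_on_partials Omega h z :
  C2_on Omega h -> Omega z ->
  is_derive (fun t => h (t, Im z)) (Re z) (dx h z) /\
  is_derive (fun t => h (Re z, t)) (Im z) (dy h z).
Proof.
  intros hC hz; destruct (hC z hz) as (_ & ex & ey & _).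
  split; apply Derive_correct; assumption.
Qed.

Lemma C2_on_has_wirtinger Omega h z :
  C2_on Omega h -> Omega z ->
  has_wirtinger (cplx h) z (dz (cplx h) z) (dzbar (cplx h) z).
Proof.
  intros hC hz; destruct (C2_on_partials _ _ _ hC hz) as [ex ey].
  pose proof (has_wirtinger_real _ _ _ _ ex ey) as w.
  destruct (has_wirtinger_unique _ _ _ _ w) as (_ & -> & ->); exact w.
Qed.

Lemma dz_cplx h z : dz (cplx h) z = RtoC (dx h z) - Ci * RtoC (dy h z).
Proof.
  unfold dz, Cdx, Cdy, cplx, dx, dy; cbn.
  rewrite !Derive_const; reflexivity.
Qed.

Lemma dzbar_cplx h z : dzbar (cplx h) z = RtoC (dx h z) + Ci * RtoC (dy h z).
Proof.
  unfold dzbar, Cdx, Cdy, cplx, dx, dy; cbn.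
  rewrite !Derive_const; reflexivity.
Qed.

Lemma C2_on_differentiable Omega h z :
  open (T := C_UniformSpace) Omega -> C2_on Omega h -> Omega z ->
  differentiable_pt_lim (fun x y => h (x, y)) (Re z) (Im z) (dx h z) (dy h z).
Proof.
  intros ho hC hz; apply filterdiff_differentiable_pt_lim.
  apply (is_derive_filterdiff (fun x y => h (x, y)) (Re z) (Im z) (fun u v => dx h (u, v))).
  - replace (Re z, Im z) with z by (destruct z; reflexivity).
    apply (filter_imp Omega); [|exact (ho z hz)].
    intros w hw; exact (proj1 (C2_on_partials _ _ _ hC hw)).
  - exact (proj2 (C2_on_partials _ _ _ hC hz)).
  - destruct (hC z hz) as (_ & _ & _ & (cx & _) & _).
    apply continuity_2d_pt_filterlim in cx; exact cx.
Qed.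

(** The imaginary part of [dzbar (dz h)] is the difference of the two mixed
    second derivatives, which vanishes by Schwarz's theorem. *)
Lemma dzbar_dz_laplacian Omega h z :
  open (T := C_UniformSpace) Omega -> C2_on Omega h -> Omega z ->
  exists p, has_wirtinger (dz (cplx h)) z p (RtoC (laplacian h z)).
Proof.
  intros ho hC hz.
  destruct (hC z hz) as (_ & _ & _ & (_ & exx & eyx & cxx & cyx) & (_ & exy & eyy & cxy & cyy)).
  assert (sch : dy (dx h) z = dx (dy h) z).
  { symmetry; apply (Schwarz (fun x y => h (x, y)) (Re z) (Im z)).
    - eapply locally_2d_impl; [|exact (open_locally_2d _ _ ho hz)].
      apply locally_2d_forall; intros u v huv.
      destruct (hC (u, v) huv) as (_ & ex & ey & (_ & _ & eyx' & _) & (_ & exy' & _)).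
      repeat split; assumption.
    - exact (proj1 cxy).
    - exact (proj1 cyx). }
  assert (wx : has_wirtinger (cplx (dx h)) z (RtoC (dx (dx h) z) - Ci * RtoC (dy (dx h) z))
                 (RtoC (dx (dx h) z) + Ci * RtoC (dy (dx h) z)))
    by (apply has_wirtinger_real; apply Derive_correct; assumption).
  assert (wy : has_wirtinger (cplx (dy h)) z (RtoC (dx (dy h) z) - Ci * RtoC (dy (dy h) z))
                 (RtoC (dx (dy h) z) + Ci * RtoC (dy (dy h) z)))
    by (apply has_wirtinger_real; apply Derive_correct; assumption).
  pose proof (has_wirtinger_minus _ _ _ _ _ _ _ wx
    (has_wirtinger_mult _ _ _ _ _ _ _ (has_wirtinger_const Ci z) wy)) as w.
  cbn beta in w; rewrite sch in w.
  eexists; apply (has_wirtinger_ext Omega _ _ _ _ _ ho hz (fun w _ => eq_sym (dz_cplx h w))).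
  replace (RtoC (laplacian h z)) with
    (dx (dx h) z + Ci * dx (dy h) z
       - (0 * cplx (dy h) z + Ci * (dx (dy h) z + Ci * dy (dy h) z))).
  - exact w.
  - unfold laplacian; apply injective_projections; cbn; ring.
Qed.

(** * Conjugation and nonvanishing *)

Lemma Cconj_R (r : R) : Cconj (RtoC r) = RtoC r.
Proof. apply injective_projections; cbn; ring. Qed.

Lemma Cconj_Ci : Cconj Ci = - Ci.
Proof. apply injective_projections; cbn; ring. Qed.

Lemma Cconj_neq_0 (c : C) : c <> 0 -> Cconj c <> 0.
Proof.
  intros hc e; apply hc; rewrite <- (Cconj_conj c), e; apply Cconj_R.
Qed.

Lemma RtoC_neq_0 (r : R) : r <> 0%R -> RtoC r <> 0.
Proof. intros hr e; apply hr; exact (RtoC_inj _ _ e). Qed.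

Lemma Ci_sqr : Ci * Ci = - (1).
Proof. apply injective_projections; cbn; ring. Qed.

Lemma Cconj_dzbar_cplx h z : Cconj (dzbar (cplx h) z) = dz (cplx h) z.
Proof.
  rewrite dz_cplx, dzbar_cplx; apply injective_projections; cbn; ring.
Qed.

Lemma Cconj_dz_cplx h z : Cconj (dz (cplx h) z) = dzbar (cplx h) z.
Proof. rewrite <- Cconj_dzbar_cplx; apply Cconj_conj. Qed.

(** * The two properties of rho *)

Lemma dz_cplx_neq_0 h z : grad h z <> (0%R, 0%R) -> dz (cplx h) z <> 0.
Proof.
  rewrite dz_cplx; intros ne e; apply ne; unfold grad.
  pose proof (f_equal Re e) as e1; pose proof (f_equal Im e) as e2; cbn in e1, e2.
  f_equal; lra.
Qed.

(** Both sides have the same real part, and the difference of their imaginary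
    parts is twice the determinant of the two gradients. *)
Lemma function_of_dzbar_dz Omega (f r : C -> R) (g : R -> R) z :
  open (T := C_UniformSpace) Omega -> C2_on Omega f -> C2_on Omega r ->
  (forall w, Omega w -> f w = g (r w)) -> Omega z ->
  dzbar (cplx f) z * dz (cplx r) z = dz (cplx f) z * dzbar (cplx r) z.
Proof.
  intros ho hf hr hg hz.
  assert (e : (dx f z * dy r z = dy f z * dx r z)%R).
  { apply (level_set_gradients_parallel (fun x y => f (x, y)) (fun x y => r (x, y))
             (Re z) (Im z)).
    - exact (C2_on_differentiable _ _ _ ho hf hz).
    - exact (C2_on_differentiable _ _ _ ho hr hz).
    - eapply locally_2d_impl; [|exact (open_locally_2d _ _ ho hz)].
      apply locally_2d_forall; intros u v huv; exact (proj1 (hr (u, v) huv)).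
    - eapply locally_2d_impl; [|exact (open_locally_2d _ _ ho hz)].
      apply locally_2d_forall; intros u v huv er.
      replace (Re z, Im z) with z in er |- * by (destruct z; reflexivity).
      rewrite !hg, er by assumption; reflexivity. }
  rewrite !dz_cplx, !dzbar_cplx; apply injective_projections; cbn; lra.
Qed.

(** The zbar-derivative of the product is
    [e^(-S(r)) (Laplacian r - s(r) r_zbar r_z)], and [r_zbar r_z = |grad r|^2]. *)
Lemma antiderivative_factor_holomorphic Omega (r : C -> R) (s S : R -> R) z :
  open (T := C_UniformSpace) Omega -> C2_on Omega r -> Omega z ->
  grad r z <> (0%R, 0%R) ->
  (laplacian r z / grad_norm2 r z)%R = s (r z) ->
  is_derive S (r z) (s (r z)) ->
  exists p, has_wirtinger (fun w => RtoC (exp (- S (r w))) * dz (cplx r) w) z p 0.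
Proof.
  intros ho hC hz ng hs hS.
  destruct (dzbar_dz_laplacian _ _ _ ho hC hz) as [p wr].
  destruct (C2_on_partials _ _ _ hC hz) as [ex ey].
  assert (ez : r (Re z, Im z) = r z) by (destruct z; reflexivity).
  assert (E : forall k t l, k t = r z -> is_derive k t l ->
     is_derive (fun x => exp (- S (k x))) t (l * (- s (r z) * exp (- S (r z))))%R).
  { intros k t l ek hl; rewrite <- ek in hS |- *.
    apply (is_derive_comp (fun x => exp (- S x))%R k t); [|exact hl].
    apply (is_derive_comp exp (fun x => - S x)%R); [apply is_derive_Reals, derivable_pt_lim_exp|].
    apply (is_derive_opp S); exact hS. }
  pose proof (has_wirtinger_real (fun w => exp (- S (r w))) z _ _
    (E _ _ _ ez ex) (E _ _ _ ez ey)) as we.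
  pose proof (has_wirtinger_mult _ _ _ _ _ _ _ we wr) as w.
  assert (nn : grad_norm2 r z <> 0%R).
  { intros e; apply ng; unfold grad, grad_norm2 in *; f_equal; nra. }
  assert (lap : laplacian r z = (s (r z) * grad_norm2 r z)%R)
    by (rewrite <- hs; field; exact nn).
  eexists; unfold cplx at 1 in w.
  match type of w with has_wirtinger _ _ _ ?b => replace (RtoC 0) with b; [exact w|] end.
  rewrite dz_cplx, lap; unfold grad_norm2, cplx.
  apply injective_projections; cbn; ring.
Qed.

(** * The pairs (Q/h, ihQ) with h real and Q holomorphic *)

Definition pair_F (h : C -> R) (Q : C -> C) (z : C) : C := Q z * (1 / RtoC (h z)).
Definition pair_G (h : C -> R) (Q : C -> C) (z : C) : C := Q z * (Ci * RtoC (h z)).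

(* The pair (F, G) is only assumed to agree with the model pair on the open set
   Omega: adjoint pairs are quotients that have this form only there. *)
Section Holomorphic_multiple.

Variables (Omega : C -> Prop) (h : C -> R) (Q F G : C -> C).
Hypothesis open_Omega : open (T := C_UniformSpace) Omega.
Hypothesis F_eq : forall z, Omega z -> F z = pair_F h Q z.
Hypothesis G_eq : forall z, Omega z -> G z = pair_G h Q z.

Section At_point.

Variables (z hz hzbar q : C).
Hypothesis z_in : Omega z.
Hypothesis h_nz : h z <> 0%R.
Hypothesis Q_nz : Q z <> 0.
Hypothesis h_wirt : has_wirtinger (cplx h) z hz hzbar.
Hypothesis Q_wirt : has_wirtinger Q z q 0.

Let h_nzC : RtoC (h z) <> 0 := RtoC_neq_0 _ h_nz.
Let Qb_nz : Cconj (Q z) <> 0 := Cconj_neq_0 _ Q_nz.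

Lemma pair_has_wirtinger :
  has_wirtinger F z (q / RtoC (h z) - Q z * hz / (RtoC (h z) * RtoC (h z)))
    (- (Q z * hzbar / (RtoC (h z) * RtoC (h z)))) /\
  has_wirtinger G z (q * Ci * RtoC (h z) + Q z * Ci * hz) (Q z * Ci * hzbar).
Proof.
  split.
  - apply (has_wirtinger_ext Omega (fun w => Q w * / cplx h w)); try assumption.
    + intros w hw; rewrite F_eq by exact hw; unfold pair_F, cplx, Cdiv; ring.
    + pose proof (has_wirtinger_mult _ _ _ _ _ _ _ Q_wirt
                    (has_wirtinger_inv _ _ _ _ h_wirt h_nzC)) as w.
      cbn beta in w; change (cplx h z) with (RtoC (h z)) in w.
      match type of w with has_wirtinger _ _ ?a ?b =>
        match goal with |- has_wirtinger _ _ ?c ?d =>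
          replace c with a by (field; exact h_nzC);
          replace d with b by (field; exact h_nzC); exact w end end.
  - apply (has_wirtinger_ext Omega (fun w => Q w * (Ci * cplx h w))); try assumption.
    + intros w hw; rewrite G_eq by exact hw; reflexivity.
    + pose proof (has_wirtinger_mult _ _ _ _ _ _ _ Q_wirt
         (has_wirtinger_mult _ _ _ _ _ _ _ (has_wirtinger_const Ci z) h_wirt)) as w.
      cbn beta in w; change (cplx h z) with (RtoC (h z)) in w.
      match type of w with has_wirtinger _ _ ?a ?b =>
        match goal with |- has_wirtinger _ _ ?c ?d =>
          replace c with a by ring; replace d with b by ring; exact w end end.
Qed.

Let F_conj : Cconj (F z) = Cconj (Q z) * (1 / RtoC (h z)).
Proof.
  rewrite F_eq by exact z_in; unfold pair_F.
  rewrite Cmult_conj, Cdiv_conj, !Cconj_R by exact h_nzC; reflexivity.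
Qed.

Let G_conj : Cconj (G z) = Cconj (Q z) * (- Ci * RtoC (h z)).
Proof.
  rewrite G_eq by exact z_in; unfold pair_G.
  rewrite !Cmult_conj, Cconj_R, Cconj_Ci; reflexivity.
Qed.

Let den_eq : pair_den F G z = - (RtoC 2 * Ci * (Q z * Cconj (Q z))).
Proof.
  unfold pair_den; rewrite F_conj, G_conj, F_eq, G_eq by exact z_in.
  unfold pair_F, pair_G; field; exact h_nzC.
Qed.

Let two_nz : RtoC 2 <> 0.
Proof. apply RtoC_neq_0; lra. Qed.

Lemma pair_orientation : (0 < Im (Cconj (F z) * G z))%R.
Proof.
  rewrite F_conj, G_eq by exact z_in; unfold pair_G.
  replace (Cconj (Q z) * (1 / h z) * (Q z * (Ci * h z)))
    with (Ci * (Q z * Cconj (Q z))) by (field; exact h_nzC).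
  rewrite <- Cmod2_conj.
  replace (Im (Ci * RtoC (Cmod (Q z) ^ 2))) with (Cmod (Q z) ^ 2)%R by (cbn; ring).
  apply pow_lt, Cmod_gt_0; exact Q_nz.
Qed.

Lemma pair_generating :
  has_Cpartials F z /\ has_Cpartials G z /\ (0 < Im (Cconj (F z) * G z))%R.
Proof.
  destruct pair_has_wirtinger as [wF wG].
  split; [exact (proj1 (has_wirtinger_unique _ _ _ _ wF))|].
  split; [exact (proj1 (has_wirtinger_unique _ _ _ _ wG))|exact pair_orientation].
Qed.

(** Everything follows from [F conj G - conj F G = -2i |Q|^2]. The
    zbar-derivative does not act on [Q]; for [B], the terms containing [Q_z]
    cancel by antisymmetry. *)
Lemma pair_coefficients :
  char_a F G z = 0 /\
  char_b F G z = - (Q z / Cconj (Q z) * (hzbar / RtoC (h z))) /\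
  char_B F G z = - (Q z / Cconj (Q z) * (hz / RtoC (h z))).
Proof.
  destruct pair_has_wirtinger as [wF wG].
  destruct (has_wirtinger_unique _ _ _ _ wF) as (_ & F1 & F2).
  destruct (has_wirtinger_unique _ _ _ _ wG) as (_ & G1 & G2).
  unfold char_a, char_b, char_B.
  rewrite den_eq, F_conj, G_conj, F1, F2, G1, G2, F_eq, G_eq by exact z_in.
  unfold pair_F, pair_G.
  split; [|split]; field; repeat split; try assumption; exact Ci_nz.
Qed.

Lemma pair_adjoint :
  adjoint_F F G z = pair_F h (fun w => / (Ci * Q w)) z /\
  adjoint_G F G z = pair_G h (fun w => / (Ci * Q w)) z.
Proof.
  unfold adjoint_F, adjoint_G; rewrite den_eq, F_conj, G_conj.
  unfold pair_F, pair_G.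
  split; field; repeat split; try assumption; exact Ci_nz.
Qed.

End At_point.
End Holomorphic_multiple.

(** * Pseudoanalyticity under a common factor *)

(** The same coefficients [phi] and [psi] serve for both functions, and the
    equation is multiplied by [c z]. *)
Lemma pseudoanalytic_rescale Omega F G w F' G' w' (c : C -> C) :
  (forall z, Omega z -> F' z = c z * F z /\ G' z = c z * G z /\ w' z = c z * w z) ->
  pseudoanalytic Omega F G w -> pseudoanalytic Omega F' G' w'.
Proof.
  intros e (phi & psi & dphi & dpsi & k); exists phi, psi.
  split; [exact dphi|split; [exact dpsi|]].
  intros z hz; destruct (e z hz) as (-> & -> & ->); destruct (k z hz) as [-> k2].
  split; [ring|].
  transitivity (c z * (dzbar (cplx phi) z * F z + dzbar (cplx psi) z * G z)); [ring|].
  rewrite k2; ring.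
Qed.

(** Both pairs are multiples of [(1/h, ih)], so [Q' / Q] is a common factor. *)
Lemma pseudoanalytic_pair Omega h Q Q' F G F' G' (phi psi : C -> R) :
  (forall z, Omega z -> F z = pair_F h Q z) ->
  (forall z, Omega z -> G z = pair_G h Q z) ->
  (forall z, Omega z -> F' z = pair_F h Q' z) ->
  (forall z, Omega z -> G' z = pair_G h Q' z) ->
  (forall z, Omega z -> Q z <> 0) ->
  pseudoanalytic Omega F G (fun z => RtoC (phi z) * F z + RtoC (psi z) * G z) ->
  pseudoanalytic Omega F' G' (fun z => RtoC (phi z) * F' z + RtoC (psi z) * G' z).
Proof.
  intros eF eG eF' eG' nz.
  apply (pseudoanalytic_rescale _ _ _ _ _ _ _ (fun z => Q' z / Q z)).
  intros z hz; rewrite eF, eG, eF', eG' by exact hz; unfold pair_F, pair_G, Cdiv.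
  assert (k : / Q z * Q z = 1) by (apply Cinv_l, nz, hz).
  assert (m : forall a, Q' z * / Q z * (Q z * a) = Q' z * a).
  { intros a; replace (Q' z * / Q z * (Q z * a)) with (Q' z * (/ Q z * Q z) * a) by ring.
    rewrite k; ring. }
  split; [|split].
  - symmetry; apply m.
  - symmetry; apply m.
  - rewrite Cmult_plus_distr_l.
    rewrite <- (m (1 * / h z)), <- (m (Ci * h z)); ring.
Qed.

(** * The generating pairs built from a solution and its phase function *)

Theorem mainTheorem11
  (Omega : C -> Prop) (u f0 rho : C -> R) (s S : R -> R)
  (hOmega : plane_domain Omega)
  (hf0C2 : C2_on Omega f0)
  (hrhoC2 : C2_on Omega rho)
  (hf0nz : forall z, Omega z -> f0 z <> 0%R)
  (hf0sol : forall z, Omega z ->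
     - dz (dzbar (cplx f0)) z + RtoC (u z) * RtoC (f0 z) = 0)
  (hf0rho : exists g : R -> R, forall z, Omega z -> f0 z = g (rho z))
  (hgrad : forall z, Omega z -> grad rho z <> (0%R, 0%R))
  (hs : forall z, Omega z -> (laplacian rho z / grad_norm2 rho z)%R = s (rho z))
  (hscont : forall z, Omega z -> continuous s (rho z))
  (hS : forall z, Omega z -> is_derive S (rho z) (s (rho z))) :
  let rhoz : C -> C := dz (cplx rho) in
  let F : C -> C := fun z => 1 / RtoC (f0 z) in
  let G : C -> C := fun z => Ci * RtoC (f0 z) in
  let FI : C -> C := fun z =>
    Ci * RtoC (f0 z) * RtoC (exp (- S (rho z))) * rhoz z in
  let GI : C -> C := fun z =>
    - (RtoC (exp (- S (rho z))) * rhoz z / RtoC (f0 z)) in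
  let b : C -> C := fun z => - (dzbar (cplx f0) z / RtoC (f0 z)) in
  let FIs : C -> C := adjoint_F FI GI in
  let GIs : C -> C := adjoint_G FI GI in
  generating_pair Omega FI GI /\
  (forall z, Omega z -> char_a FI GI z = 0 /\ char_b FI GI z = Cconj (b z)) /\
  (forall z, Omega z ->
     FIs z = - (RtoC (f0 z) * RtoC (exp (S (rho z))) / rhoz z) /\
     GIs z = - (Ci * RtoC (exp (S (rho z))) / (RtoC (f0 z) * rhoz z))) /\
  (forall phi psi : C -> R,
     pseudoanalytic Omega FI GI
       (fun z => RtoC (phi z) * FI z + RtoC (psi z) * GI z) <->
     pseudoanalytic Omega FIs GIs
       (fun z => RtoC (phi z) * FIs z + RtoC (psi z) * GIs z)) /\
  successor Omega FIs GIs F G.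
Proof.
  intros rhoz F G FI GI b FIs GIs.
  destruct hf0rho as [g hg]; destruct hOmega as [ho _].
  (* In the notation of the pairs above: (F_I, G_I) is given by h and Q, its
     adjoint by h and Qs = -1/P, and (F, G) by f0 and the constant 1. *)
  set (h := fun z => (/ f0 z)%R).
  set (P := fun z => RtoC (exp (- S (rho z))) * rhoz z).
  set (Q := fun z => Ci * P z).
  set (Qs := fun z => / (Ci * Q z)).
  assert (f_nz : forall z, Omega z -> RtoC (f0 z) <> 0)
    by (intros; apply RtoC_neq_0, hf0nz; assumption).
  assert (h_nz : forall z, Omega z -> h z <> 0%R)
    by (intros z hz; exact (Rinv_neq_0_compat _ (hf0nz z hz))).
  assert (h_inv : forall z, Omega z -> RtoC (h z) = / RtoC (f0 z))
    by (intros z hz; exact (RtoC_inv _ (hf0nz z hz))).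
  assert (E_nz : forall x, RtoC (exp x) <> 0)
    by (intros x; apply RtoC_neq_0; pose proof (exp_pos x); lra).
  assert (rhoz_nz : forall z, Omega z -> rhoz z <> 0)
    by (intros z hz; exact (dz_cplx_neq_0 _ _ (hgrad z hz))).
  assert (P_nz : forall z, Omega z -> P z <> 0)
    by (intros z hz; exact (Cmult_neq_0 _ _ (E_nz _) (rhoz_nz z hz))).
  assert (Q_nz : forall z, Omega z -> Q z <> 0)
    by (intros z hz; exact (Cmult_neq_0 _ _ Ci_nz (P_nz z hz))).
  assert (Qs_eq : forall z, Omega z -> Qs z = - / P z).
  { intros z hz; unfold Qs, Q.
    replace (Ci * (Ci * P z)) with (- P z) by (rewrite Cmult_assoc, Ci_sqr; ring).
    field; exact (P_nz z hz). }
  assert (Qs_nz : forall z, Omega z -> Qs z <> 0).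
  { intros z hz e; apply C1_nz; unfold Qs in e.
    rewrite <- (Cinv_l (Ci * Q z)), e by exact (Cmult_neq_0 _ _ Ci_nz (Q_nz z hz)); ring. }
  assert (wf : forall z, Omega z ->
            has_wirtinger (cplx f0) z (dz (cplx f0) z) (dzbar (cplx f0) z))
    by (intros z hz; exact (C2_on_has_wirtinger _ _ _ hf0C2 hz)).
  assert (wh : forall z, Omega z -> has_wirtinger (cplx h) z
            (- (dz (cplx f0) z / (RtoC (f0 z) * RtoC (f0 z))))
            (- (dzbar (cplx f0) z / (RtoC (f0 z) * RtoC (f0 z))))).
  { intros z hz; apply (has_wirtinger_ext Omega (fun w => / cplx f0 w)); try assumption.
    - intros w hw; symmetry; exact (h_inv w hw).
    - exact (has_wirtinger_inv _ _ _ _ (wf z hz) (f_nz z hz)). }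
  assert (wQ : forall z, Omega z -> exists q, has_wirtinger Q z q 0).
  { intros z hz.
    destruct (antiderivative_factor_holomorphic _ _ _ _ _ ho hrhoC2 hz
                (hgrad z hz) (hs z hz) (hS z hz)) as [p wp].
    pose proof (has_wirtinger_mult _ _ _ _ _ _ _ (has_wirtinger_const Ci z) wp) as w.
    eexists; match type of w with has_wirtinger _ _ _ ?b =>
      replace (RtoC 0) with b; [exact w|ring] end. }
  assert (wQs : forall z, Omega z -> exists q, has_wirtinger Qs z q 0).
  { intros z hz; destruct (wQ z hz) as [q wq].
    pose proof (has_wirtinger_inv _ _ _ _
      (has_wirtinger_mult _ _ _ _ _ _ _ (has_wirtinger_const Ci z) wq)
      (Cmult_neq_0 _ _ Ci_nz (Q_nz z hz))) as w; cbn beta in w.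
    eexists; match type of w with has_wirtinger _ _ _ ?b =>
      replace (RtoC 0) with b; [exact w|] end.
    field; split; [exact (Q_nz z hz)|exact Ci_nz]. }
  assert (eFI : forall z, Omega z -> FI z = pair_F h Q z).
  { intros z hz; unfold FI, pair_F, Q, P; rewrite h_inv by exact hz.
    field; exact (f_nz z hz). }
  assert (eGI : forall z, Omega z -> GI z = pair_G h Q z).
  { intros z hz; unfold GI, pair_G, Q; rewrite h_inv by exact hz.
    replace (Ci * P z * (Ci * / f0 z)) with (Ci * Ci * (P z / f0 z))
      by (field; exact (f_nz z hz)).
    rewrite Ci_sqr; unfold P; field; exact (f_nz z hz). }
  assert (eS : forall z, Omega z -> FIs z = pair_F h Qs z /\ GIs z = pair_G h Qs z)
    by (intros z hz;
        exact (pair_adjoint Omega h Q FI GI eFI eGI z hz (h_nz z hz) (Q_nz z hz))).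
  assert (eFIs : forall z, Omega z -> FIs z = pair_F h Qs z)
    by (intros z hz; exact (proj1 (eS z hz))).
  assert (eGIs : forall z, Omega z -> GIs z = pair_G h Qs z)
    by (intros z hz; exact (proj2 (eS z hz))).
  assert (eF : forall z, Omega z -> F z = pair_F f0 (fun _ => 1) z)
    by (intros z hz; unfold F, pair_F; ring).
  assert (eG : forall z, Omega z -> G z = pair_G f0 (fun _ => 1) z)
    by (intros z hz; unfold G, pair_G; ring).
  (* P / conj P = rho_z / rho_zbar since the exponential is real, and the
     gradients of f0 and rho are parallel. *)
  assert (turn : forall z, Omega z ->
            P z * dzbar (cplx f0) z = Cconj (P z) * dz (cplx f0) z).
  { intros z hz; unfold P, rhoz; rewrite Cmult_conj, Cconj_R, Cconj_dz_cplx.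
    rewrite <- !Cmult_assoc; f_equal.
    rewrite (Cmult_comm (dz (cplx rho) z)), (Cmult_comm (dzbar (cplx rho) z)).
    exact (function_of_dzbar_dz _ _ _ _ _ ho hf0C2 hrhoC2 hg hz). }
  assert (gpI : generating_pair Omega FI GI).
  { intros z hz; destruct (wQ z hz) as [q wq].
    eapply pair_generating; eauto. }
  assert (gpS : generating_pair Omega FIs GIs).
  { intros z hz; destruct (wQs z hz) as [q wq].
    eapply pair_generating; eauto. }
  assert (gp : generating_pair Omega F G).
  { intros z hz. eapply pair_generating; eauto; [exact C1_nz|apply has_wirtinger_const]. }
  split; [exact gpI|split; [|split; [|split; [|split; [exact gpS|split; [exact gp|]]]]]].
  - intros z hz; destruct (wQ z hz) as [q wq].
    destruct (pair_coefficients Omega h Q FI GI ho eFI eGI z _ _ _ hz (h_nz z hz)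
                (Q_nz z hz) (wh z hz) wq) as (ea & eb & _).
    split; [exact ea|rewrite eb].
    unfold b; rewrite Copp_conj, Cdiv_conj, Cconj_R, Cconj_dzbar_cplx by exact (f_nz z hz).
    rewrite h_inv by exact hz; unfold Q; rewrite Cmult_conj, Cconj_Ci.
    pose proof (Cconj_neq_0 _ (P_nz z hz)) as pb.
    replace (dz (cplx f0) z) with (P z * dzbar (cplx f0) z / Cconj (P z))
      by (rewrite (turn z hz); field; exact pb).
    field; repeat split; try exact pb; try exact (f_nz z hz); exact Ci_nz.
  - intros z hz; rewrite eFIs, eGIs by exact hz; unfold pair_F, pair_G.
    rewrite Qs_eq, h_inv by exact hz; unfold P.
    rewrite exp_Ropp, RtoC_inv by (pose proof (exp_pos (S (rho z))); lra).
    split; field; repeat split; auto.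
  - intros phi psi; split.
    + apply (pseudoanalytic_pair Omega h Q Qs); assumption.
    + apply (pseudoanalytic_pair Omega h Qs Q); assumption.
  - intros z hz; destruct (wQs z hz) as [q wq].
    destruct (pair_coefficients Omega h Qs FIs GIs ho eFIs eGIs z _ _ _ hz (h_nz z hz)
                (Qs_nz z hz) (wh z hz) wq) as (ea & _ & eB).
    destruct (pair_coefficients Omega f0 (fun _ => 1) F G ho eF eG z _ _ _ hz (hf0nz z hz)
                C1_nz (wf z hz) (has_wirtinger_const 1 z)) as (ea' & eb' & _).
    rewrite ea, ea', eb', eB; split; [reflexivity|].
    rewrite Qs_eq, h_inv, Cconj_R, Copp_conj, Cinv_conj by auto.
    pose proof (Cconj_neq_0 _ (P_nz z hz)) as pb.
    replace (dzbar (cplx f0) z) with (Cconj (P z) * dz (cplx f0) z / P z)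
      by (rewrite <- (turn z hz); field; auto).
    field; repeat split; auto; exact C1_nz.
Qed.
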